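(* For every formula $\varphi$ of $\mathcal{L}_{\mathsf{DPL}}$, if $\varphi$ is a theorem of $\mathcal{H}^{-}_{\mathsf{DPL}}$, then $\varphi$ is valid in every dynamic Markov process (i.e. $\vDash\varphi$).
   Context: Let $\mathbb{P}$ be a countable set of propositional variables. The formulas of $\mathcal{L}_{\mathsf{DPL}}$ are given by $\varphi ::= p \mid \neg\varphi \mid \varphi\wedge\varphi \mid L_r\varphi \mid \bigcirc\varphi$ with $p\in\mathbb{P}$, $r\in\mathbb{Q}\cap[0,1]$; $\bigcirc^n$ is $n$-fold iteration of $\bigcirc$. A dynamic Markov process is $\langle\Omega,\mathcal{A},T,f\rangle$ where $\langle\Omega,\mathcal{A}\rangle$ is a measurable space, $T:\Omega\times\mathcal{A}\to[0,1]$ is a Markov kernel ($T(w,\cdot)$ is a probability measure for each $w$, $T(\cdot,A)$ is measurable for each $A$), and $f:\Omega\to\Omega$ is measurable. A model on it adds a valuation $v:\mathbb{P}\to\mathcal{A}$; satisfaction: $w\vDash p$ iff $w\in v(p)$; Boolean clauses as usual; $w\vDash L_r\varphi$ iff $T(w,[\![\varphi]\!])\ge r$ where $[\![\varphi]\!]=\{u\in\Omega\mid u\vDash\varphi\}$; $w\vDash\bigcirc\varphi$ iff $f(w)\vDash\varphi$. $\vDash\varphi$ means $\varphi$ holds at every world of every model based on every dynamic Markov process. The Hilbert system $\mathcal{H}^{-}_{\mathsf{DPL}}$ has the axiom schemes: propositional tautologies; $L_0\bot$; $L_r\neg\varphi\to\neg L_s\varphi$ if $r+s>1$; $L_r(\varphi\wedge\psi)\wedge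 L_s(\varphi\wedge\neg\psi)\to L_{r+s}\varphi$ if $r+s\le 1$; $\neg L_r(\varphi\wedge\psi)\wedge\neg L_s(\varphi\wedge\neg\psi)\to\neg L_{r+s}\varphi$ if $r+s\le1$; $L_1(\varphi\to\psi)\to(L_r\varphi\to L_r\psi)$; $\bigcirc\neg\varphi\leftrightarrow\neg\bigcirc\varphi$; $\bigcirc(\varphi\wedge\psi)\leftrightarrow(\bigcirc\varphi\wedge\bigcirc\psi)$; and rules: modus ponens; from $\{\psi\to\bigcirc^nL_s\varphi \mid s<r,\ s\in\mathbb{Q}\cap[0,1]\}$ infer $\psi\to\bigcirc^nL_r\varphi$ (each $n\in\mathbb{N}$); from $\varphi$ infer $L_1\varphi$; from $\varphi$ infer $\bigcirc\varphi$. Theorems are last elements of (possibly transfinite, countable-length) derivations in which each element is an axiom or follows by a rule from earlier elements. *)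

(* Defs.v *)
From HB Require Import structures.
From mathcomp Require Import all_boot all_order all_algebra.
From mathcomp Require Import all_classical all_reals all_analysis.

Set Implicit Arguments.
Unset Strict Implicit.
Unset Printing Implicit Defensive.

Import Order.TTheory GRing.Theory Num.Theory.

Local Open Scope classical_set_scope.
Local Open Scope ring_scope.

Definition unit_rat := {r : rat | 0 <= r <= 1}.

Lemma unit_rat0_subproof : 0 <= (0 : rat) <= 1.
Proof. by rewrite lexx ler01. Qed.

Lemma unit_rat1_subproof : 0 <= (1 : rat) <= 1.
Proof. by rewrite lexx ler01. Qed.

Definition unit_rat0 : unit_rat := exist _ 0 unit_rat0_subproof.
Definition unit_rat1 : unit_rat := exist _ 1 unit_rat1_subproof.

Inductive formula (P : Type) : Type :=
| Var of P
| Neg of formula P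
| And of formula P & formula P
| Lge of unit_rat & formula P
| Next of formula P.

Definition Imp P (phi psi : formula P) := Neg (And phi (Neg psi)).
Definition Iff P (phi psi : formula P) := And (Imp phi psi) (Imp psi phi).

(* The language has no primitive falsum: any contradiction [phi /\ ~ phi] is
   accepted as a reading of it in the axiom [L_0 falsum]. *)
Definition Bot P (phi : formula P) := And phi (Neg phi).

Definition Nextn P (n : nat) (phi : formula P) := iter n (@Next P) phi.

(* Variables and formulas headed by [L_r] or [Next] are propositional atoms. *)
Fixpoint prop_eval P (b : formula P -> bool) (phi : formula P) : bool :=
  match phi with
  | Neg psi => ~~ prop_eval b psi
  | And psi chi => prop_eval b psi && prop_eval b chi
  | _ => b phi
  end.

Definition tautology P (phi : formula P) := forall b, prop_eval b phi.

Inductive is_axiom P : formula P -> Prop :=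
| ax_taut phi of tautology phi : is_axiom phi
| ax_bot phi : is_axiom (Lge unit_rat0 (Bot phi))
| ax_neg r s phi of 1 < val r + val s :
    is_axiom (Imp (Lge r (Neg phi)) (Neg (Lge s phi)))
| ax_add r s t phi psi of val t = val r + val s :
    is_axiom (Imp (And (Lge r (And phi psi)) (Lge s (And phi (Neg psi))))
                  (Lge t phi))
| ax_subadd r s t phi psi of val t = val r + val s :
    is_axiom (Imp (And (Neg (Lge r (And phi psi)))
                       (Neg (Lge s (And phi (Neg psi)))))
                  (Neg (Lge t phi)))
| ax_mono r phi psi :
    is_axiom (Imp (Lge unit_rat1 (Imp phi psi)) (Imp (Lge r phi) (Lge r psi)))
| ax_next_neg phi : is_axiom (Iff (Next (Neg phi)) (Neg (Next phi)))
| ax_next_and phi psi :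
    is_axiom (Iff (Next (And phi psi)) (And (Next phi) (Next psi))).

(* [is_rule Gamma phi]: from the set of premises [Gamma], infer [phi]. *)
Inductive is_rule P : set (formula P) -> formula P -> Prop :=
| rule_mp phi psi : is_rule [set phi; Imp phi psi] psi
| rule_arch n r phi psi :
    is_rule [set Imp psi (Nextn n (Lge s phi)) | s in
               [set s : unit_rat | val s < val r]]
            (Imp psi (Nextn n (Lge r phi)))
| rule_necL phi : is_rule [set phi] (Lge unit_rat1 phi)
| rule_necN phi : is_rule [set phi] (Next phi).

Definition is_derivation P d (I : orderType d) (D : I -> formula P) : Prop :=
  forall i, is_axiom (D i) \/
    exists2 Gamma, is_rule Gamma (D i)
      & Gamma `<=` [set D j | j in [set j | (j < i)%O]].

(* A derivation of countable ordinal length is indexed by a countable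
   well-ordered type. *)
Definition is_theorem P (phi : formula P) : Prop :=
  exists (d : Order.disp_t) (I : orderType d) (D : I -> formula P),
    [/\ wochoice.well_order (<=%O : rel I), countable [set: I],
        is_derivation D
      & exists2 l : I, (forall i, i <= l)%O & D l = phi].

Record dynamic_markov_process (R : realType) := DynamicMarkovProcess {
  dmp_display : measure_display;
  world : measurableType dmp_display;
  transition : R.-pker world ~> world;
  dynamics : {mfun world >-> world}
}.

Record valuation (P : Type) (R : realType) (X : dynamic_markov_process R) :=
  Valuation {
    val_set :> P -> set (world X);
    measurable_val_set : forall p, measurable (val_set p)
  }.

Fixpoint sat (P : Type) (R : realType) (X : dynamic_markov_process R)
    (v : valuation P X) (w : world X) (phi : formula P) : Prop :=
  match phi with
  | Var p => v p w
  | Neg psi => ~ sat v w psi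
  | And psi chi => sat v w psi /\ sat v w chi
  | Lge r psi => ((ratr (val r))%:E <= transition X w [set u | sat v u psi])%E
  | Next psi => sat v (dynamics X w) psi
  end.

Definition valid (P : Type) (R : realType) (phi : formula P) : Prop :=
  forall (X : dynamic_markov_process R) (v : valuation P X) (w : world X),
    sat v w phi.

(* Main.v *)
(* Satisfaction sets are measurable, so every world assigns each formula a
   probability, which is finitely additive over the Boolean connectives; the
   axioms then reduce to inequalities between real numbers. The infinitary rule
   is sound because the rationals of [0, 1] below [r] have supremum [r], or [r]
   is [0]. Derivations being well-ordered, a least invalid line would contradict
   the soundness of its justification. *)
Require Import Defs.
From mathcomp Require Import all_boot all_order all_algebra.
From mathcomp Require Import all_classical all_reals all_analysis.
From mathcomp Require Import lra.

Set Implicit Arguments.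
Unset Strict Implicit.
Unset Printing Implicit Defensive.

Import Order.TTheory GRing.Theory Num.Theory.

Local Open Scope classical_set_scope.
Local Open Scope ring_scope.

Section Satisfaction.
Variables (P : Type) (R : realType) (X : dynamic_markov_process R).
Variable v : valuation P X.
Implicit Types (w : world X) (phi psi : formula P) (r : unit_rat).

Lemma measurable_sat phi : measurable [set w | sat v w phi].
Proof.
elim: phi => [p|phi IH|phi IH psi IH'|r phi IH|phi IH] /=.
- exact: measurable_val_set.
- exact: measurableC.
- exact: measurableI.
(* A superlevel set of the map sending [w] to the mass of the set defined by [phi]; a kernel is
   measurable in [w] only for a measurable set, which [IH] supplies. *)
- rewrite -[Y in measurable Y]setTI.
  apply: measurable_realfun.emeasurable_fun_c_infty => //.
  exact: measurable_kernel (transition X) _ IH.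
- rewrite -[Y in measurable Y]setTI.
  exact: (measurable_funPT (dynamics X) measurableT _ IH).
Qed.

(** Real-valued, so that the probabilistic axioms become linear arithmetic; [fine] loses nothing
    because the mass is at most 1. *)
Definition sat_prob w phi : R := fine (transition X w [set u | sat v u phi]).

Lemma sat_probE w phi :
  transition X w [set u | sat v u phi] = (sat_prob w phi)%:E.
Proof.
rewrite /sat_prob fineK// ge0_fin_numE//.
apply: (@le_lt_trans _ _ 1%E); last exact: ltry.
rewrite -(prob_kernel (s := transition X) w).
by apply: le_measure; rewrite ?inE//; exact: measurable_sat.
Qed.

Lemma sat_LgeE w r phi :
  sat v w (Lge r phi) = (ratr (val r) <= sat_prob w phi :> R).
Proof. by rewrite /= sat_probE lee_fin. Qed.

Lemma sat_prob_ge0 w phi : 0 <= sat_prob w phi.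
Proof. by rewrite -lee_fin -sat_probE. Qed.

Lemma le_sat_prob w phi psi : (forall u, sat v u phi -> sat v u psi) ->
  sat_prob w phi <= sat_prob w psi.
Proof.
move=> phipsi; rewrite -lee_fin -!sat_probE.
by apply: le_measure; rewrite ?inE//; exact: measurable_sat.
Qed.

Lemma sat_prob_split w phi psi :
  sat_prob w phi = sat_prob w (And phi psi) + sat_prob w (And phi (Neg psi)).
Proof.
apply: EFin_inj; rewrite EFinD -!sat_probE addeC.
exact: measureDI (measurable_sat phi) (measurable_sat psi).
Qed.

Lemma sat_prob_Neg w phi : sat_prob w (Neg phi) = 1 - sat_prob w phi.
Proof.
suff : sat_prob w (Neg phi) + sat_prob w phi = 1 by lra.
apply: EFin_inj; rewrite EFinD -!sat_probE -(prob_kernel (s := transition X) w).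
by rewrite [RHS](measureDI _ measurableT (measurable_sat phi)) setTI setTD.
Qed.

Lemma sat_NegE w phi : sat v w (Neg phi) = ~ sat v w phi.
Proof. by []. Qed.

Lemma sat_AndE w phi psi : sat v w (And phi psi) = (sat v w phi /\ sat v w psi).
Proof. by []. Qed.

Lemma sat_Imp w phi psi : sat v w (Imp phi psi) <-> (sat v w phi -> sat v w psi).
Proof.
split=> [nphi hphi|hpsi [/hpsi]//].
by apply: contrapT => npsi; exact: nphi.
Qed.

Lemma sat_Iff w phi psi :
  sat v w (Iff phi psi) <-> (sat v w phi <-> sat v w psi).
Proof.
split; first by case=> /sat_Imp ? /sat_Imp.
by case=> ? ?; split; exact/sat_Imp.
Qed.

Lemma sat_Nextn w n phi :
  sat v w (Nextn n phi) <-> sat v (iter n (dynamics X) w) phi.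
(* The world varies in the induction: the outermost [Next] applies the dynamics first, hence
   innermost in the iterate. *)
Proof. by elim: n w => [|n IH] w //=; rewrite IH -iterSr. Qed.

(** Truth at [w] is itself a Boolean assignment to the propositional atoms, which makes tautologies
    sound. *)
Lemma sat_prop_eval w phi :
  prop_eval (fun psi => `[< sat v w psi >]) phi = `[< sat v w phi >].
Proof.
elim: phi => //= [phi ->|phi -> psi ->]; first by rewrite asbool_neg.
by rewrite asbool_and.
Qed.

Lemma sat_axiom w phi : is_axiom phi -> sat v w phi.
Proof.
case=> {phi}.
- move=> phi /(_ (fun psi => `[< sat v w psi >])).
  by rewrite sat_prop_eval => /asboolP.
- by move=> phi; rewrite sat_LgeE rmorph0 sat_prob_ge0.
- move=> r s phi rs; apply/sat_Imp; rewrite sat_LgeE sat_prob_Neg => hr.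
  rewrite sat_NegE sat_LgeE => hs.
  have : ratr (val r + val s) <= 1 :> R by rewrite rmorphD /=; lra.
  by rewrite -(rmorph1 (@ratr R)) ler_rat leNgt rs.
- move=> r s t phi psi tE; apply/sat_Imp.
  rewrite sat_AndE !sat_LgeE => -[hr hs].
  by rewrite tE rmorphD (sat_prob_split w phi psi) lerD.
- move=> r s t phi psi tE; apply/sat_Imp.
  rewrite sat_AndE !sat_NegE !sat_LgeE.
  move=> -[/negP + /negP]; rewrite -!ltNge => hr hs; apply/negP; rewrite -ltNge.
  by rewrite tE rmorphD (sat_prob_split w phi psi) ltrD.
(* [Imp phi psi] unfolds to a negation, so [h] forces [And phi (Neg psi)] to have probability 0. *)
- move=> r phi psi; apply/sat_Imp; rewrite sat_LgeE sat_prob_Neg rmorph1 => h.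
  apply/sat_Imp; rewrite !sat_LgeE (sat_prob_split w phi psi) => hr.
  have : sat_prob w (And phi psi) <= sat_prob w psi by apply: le_sat_prob => u [].
  by lra.
- by move=> phi; apply/sat_Iff => /=.
- by move=> phi psi; apply/sat_Iff => /=.
Qed.

(** If [x] were below [r], density would give a rational [q] strictly between them, and [0 <= x]
    with [r <= 1] puts [q] in the unit interval. For [r = 0] the family of bounds is empty and
    [0 <= x] is the claim. *)
Lemma unit_rat_approx r (x : R) : 0 <= x ->
  (forall s : unit_rat, val s < val r -> ratr (val s) <= x) -> ratr (val r) <= x.
Proof.
move=> x0 hx; rewrite leNgt; apply/negP => /rat_in_itvoo[q].
rewrite in_itv/= => /andP[xq]; rewrite ltr_rat => qr.
have q01 : 0 <= q <= 1.
  apply/andP; split; last by case/andP: (valP r) => _; apply: le_trans; exact: ltW.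
  by rewrite -(ler_rat R) rmorph0 (le_trans x0) ?ltW.
by have := hx (exist _ q q01) qr; rewrite leNgt xq.
Qed.

End Satisfaction.

Section Soundness.
Variables (P : Type) (R : realType).
Implicit Types (phi : formula P) (Gamma : set (formula P)).

(** Premises are taken valid, not just true at [w]: necessitation inspects them at all worlds or at
    the next one. *)
Lemma valid_rule Gamma phi : is_rule Gamma phi ->
  (forall psi, Gamma psi -> valid R psi) -> valid R phi.
Proof.
case=> {Gamma phi} [phi psi|n r phi psi|phi|phi] hG X v w.
- by have /sat_Imp := hG _ (or_intror erefl) X v w; apply; apply: hG; left.
(* Moving to the [n]-th iterate of [w] leaves bounds on one fixed probability. *)
- apply/sat_Imp => hpsi; rewrite sat_Nextn sat_LgeE.
  apply: unit_rat_approx => [|s sr]; first exact: sat_prob_ge0.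
  rewrite -sat_LgeE -sat_Nextn; move: hpsi; apply/sat_Imp.
  by apply: hG; exists s.
- rewrite sat_LgeE rmorph1 -lee_fin -sat_probE.
  rewrite (_ : [set u | _] = setT) ?prob_kernel//.
  by rewrite -subTset => u _; exact: hG.
- exact: (hG phi erefl X v (dynamics X w)).
Qed.

Lemma valid_derivation d (I : orderType d) (D : I -> formula P) :
  wochoice.well_order (<=%O : rel I) -> is_derivation D ->
  forall i, valid R (D i).
Proof.
move=> woI derD i; apply: contrapT => Ni.
have [|m [[/asboolP Nm minm] _]] := woI (fun j => `[< ~ valid R (D j) >]).
  by exists i; exact/asboolP.
apply: Nm; case: (derD m) => [axm X v w|[Gamma ruleG subG]].
  exact: sat_axiom.
apply: (valid_rule ruleG) => psi /subG[j jm <-]; apply: contrapT => Nj.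
have : (m <= j)%O by apply: minm; exact/asboolP.
by rewrite leNgt jm.
Qed.

End Soundness.

Theorem theorem2p10 (R : realType) (P : countType) (phi : formula P) :
  is_theorem phi -> valid R phi.
Proof.
move=> [d [I [D [woI _ derD [l _ <-]]]]].
exact: valid_derivation woI derD l.
Qed.
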